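(* Let $k\in\mathbb{N}$. For $1\le i\le k$ let $X_i$ be a real Banach space, let $Y_i$ and $Z_{1i}$ be closed linear subspaces of $X_i$, let $Z_{2i}=Y_i\cap Z_{1i}$, and suppose that $Z_{2i}$ is locally constrained with respect to $Z_{1i}$ via $Y_i$. Let $\pi$ be a polyhedral nondecreasing norm on $\mathbb{R}^k_+$, and let $X=(\oplus X_i)_\pi$, $Y=(\oplus Y_i)_\pi$, $Z_1=(\oplus Z_{1i})_\pi$ and $Z_2=(\oplus Z_{2i})_\pi$ be the corresponding polyhedral direct sums. If $Z_1$ is a central subspace of $X$, then $Z_2$ is a central subspace of $Y$.
   Context: All Banach spaces are real; ''subspace'' means closed linear subspace; $B_X(x,r)$ denotes the closed ball in $X$ with center $x$ and radius $r>0$. Polyhedral direct sum: a function $\pi:\mathbb{R}^k_+\to\mathbb{R}_+$ is a norm if it is subadditive, positively homogeneous, and $\pi(t)=0\iff t=0$. It is polyhedral if $\pi(t)=\max_{1\le j\le l}g_j(t)$ for some $g_1,\dots,g_l\in(\mathbb{R}^k)^*$. For a polyhedral nondecreasing (coordinatewise) norm $\pi$ on $\mathbb{R}^k_+$, $(\oplus X_i)_\pi$ denotes $X_1\oplus\cdots\oplus X_k$ with norm $\|x\|_\pi=\pi(\|x(1)\|,\dots,\|x(k)\|)$ for $x=(x(1),\dots,x(k))$. Central subspace: a subspace $Y$ of a Banach space $X$ is a central subspace of $X$ if every finite family of closed balls with centers in $Y$ that has nonempty intersection in $X$ also intersects in $Y$; i.e. for all $y_1,\dots,y_n\in Y$ and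 $r_1,\dots,r_n>0$, $\bigcap_{i=1}^n B_X(y_i,r_i)\neq\emptyset$ implies $Y\cap\bigcap_{i=1}^n B_X(y_i,r_i)\neq\emptyset$. Locally constrained: for subspaces $Z_1,Y$ of $X$ and $Z_2=Z_1\cap Y$, $Z_2$ is locally constrained with respect to $Z_1$ via $Y$ if for every $z\in Z_1$ there are linear projections $P:\operatorname{span}\{z,Z_2\}\to Z_2$ (onto $Z_2$) and $Q:\operatorname{span}\{z,Y\}\to Y$ (onto $Y$) of norm one such that $Pz=Qz$. *)

(* Defs.v *)
From HB Require Import structures.
From mathcomp Require Import all_boot all_order all_algebra.
From mathcomp Require Import all_classical all_reals all_analysis.
Set Implicit Arguments.
Unset Strict Implicit.
Unset Printing Implicit Defensive.
Import Order.TTheory GRing.Theory Num.Theory.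
Import numFieldNormedType.Exports.
Local Open Scope classical_set_scope.
Local Open Scope ring_scope.

(* R^k_+ is the set of vectors t with nonneg_vec t; a function on R^k_+ is    *)
(* encoded by a total function on 'rV[R]_k, and every condition below         *)
(* constrains its values on R^k_+ only.                                       *)
Definition nonneg_vec (R : realType) (k : nat) (t : 'rV[R]_k) : Prop :=
  forall i, 0 <= t ord0 i.

Lemma nonneg_vecD (R : realType) (k : nat) (s t : 'rV[R]_k) :
  nonneg_vec s -> nonneg_vec t -> nonneg_vec (s + t).
Proof. by move=> s0 t0 i; rewrite mxE addr_ge0. Qed.

Definition orthant_norm (R : realType) (k : nat) (pi : 'rV[R]_k -> R) : Prop :=
  [/\ (forall t, nonneg_vec t -> 0 <= pi t),
      (forall s t, nonneg_vec s -> nonneg_vec t -> pi (s + t) <= pi s + pi t),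
      (forall a t, 0 <= a -> nonneg_vec t -> pi (a *: t) = a * pi t) &
      (forall t, nonneg_vec t -> pi t = 0 <-> t = 0)].

(* The functionals are g_0, ..., g_l, so that there is at least one.          *)
Definition orthant_polyhedral (R : realType) (k : nat) (pi : 'rV[R]_k -> R) :
    Prop :=
  exists (l : nat) (g : 'I_l.+1 -> {scalar 'rV[R]_k}),
    forall t, nonneg_vec t -> pi t = \big[Num.max/g ord0 t]_(j < l.+1) g j t.

Definition orthant_nondecreasing (R : realType) (k : nat)
    (pi : 'rV[R]_k -> R) : Prop :=
  forall s t, nonneg_vec s -> nonneg_vec t ->
    (forall i, s ord0 i <= t ord0 i) -> pi s <= pi t.

Record polyhedral_norm (R : realType) (k : nat) := PolyhedralNorm {
  pnorm_fun :> 'rV[R]_k -> R ;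
  pnorm_norm : orthant_norm pnorm_fun ;
  pnorm_polyhedral : orthant_polyhedral pnorm_fun ;
  pnorm_nondecreasing : orthant_nondecreasing pnorm_fun }.

Definition dsum (R : realType) (k : nat) (pi : polyhedral_norm R k)
  (X : 'I_k -> completeNormedModType R) : Type := forall i, X i.

HB.instance Definition _ (R : realType) (k : nat) (pi : polyhedral_norm R k)
  (X : 'I_k -> completeNormedModType R) :=
  Choice.copy (dsum pi X) (forall i, X i).

Section DsumZmodule.
Context (R : realType) (k : nat) (pi : polyhedral_norm R k).
Context (X : 'I_k -> completeNormedModType R).
Implicit Types x y z : dsum pi X.

Definition dsum_zero : dsum pi X := fun i => 0.
Definition dsum_opp x : dsum pi X := fun i => - x i.
Definition dsum_add x y : dsum pi X := fun i => x i + y i.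
Definition dsum_scale (a : R) x : dsum pi X := fun i => a *: x i.

Lemma dsum_addA : associative dsum_add.
Proof. by move=> x y z; apply: functional_extensionality_dep => i; exact: addrA. Qed.

Lemma dsum_addC : commutative dsum_add.
Proof. by move=> x y; apply: functional_extensionality_dep => i; exact: addrC. Qed.

Lemma dsum_add0 : left_id dsum_zero dsum_add.
Proof. by move=> x; apply: functional_extensionality_dep => i; exact: add0r. Qed.

Lemma dsum_addN : left_inverse dsum_zero dsum_opp dsum_add.
Proof. by move=> x; apply: functional_extensionality_dep => i; exact: addNr. Qed.

HB.instance Definition _ := GRing.isZmodule.Build (dsum pi X)
  dsum_addA dsum_addC dsum_add0 dsum_addN.

Lemma dsum_scaleA a b x : dsum_scale a (dsum_scale b x) = dsum_scale (a * b) x.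
Proof. by apply: functional_extensionality_dep => i; exact: scalerA. Qed.

Lemma dsum_scale1 : left_id 1 dsum_scale.
Proof. by move=> x; apply: functional_extensionality_dep => i; exact: scale1r. Qed.

Lemma dsum_scaleDr : right_distributive dsum_scale +%R.
Proof. by move=> a x y; apply: functional_extensionality_dep => i; exact: scalerDr. Qed.

Lemma dsum_scaleDl x : {morph dsum_scale^~ x : a b / a + b}.
Proof. by move=> a b; apply: functional_extensionality_dep => i; exact: scalerDl. Qed.

HB.instance Definition _ := GRing.Zmodule_isLmodule.Build R (dsum pi X)
  dsum_scaleA dsum_scale1 dsum_scaleDr dsum_scaleDl.

Definition dsum_norm x : R := pi (\row_i `|x i|).

Lemma nonneg_norms x : nonneg_vec (\row_i `|x i|).
Proof. by move=> i; rewrite mxE. Qed.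

Lemma dsum_normD x y : dsum_norm (x + y) <= dsum_norm x + dsum_norm y.
Proof.
have [_ piD _ _] := pnorm_norm pi.
apply: le_trans (piD _ _ (nonneg_norms x) (nonneg_norms y)).
apply: pnorm_nondecreasing => [||i]; first exact: nonneg_norms.
  by move=> i; rewrite !mxE addr_ge0.
by rewrite !mxE; exact: ler_normD.
Qed.

Lemma dsum_normZ (a : R) x : dsum_norm (a *: x) = `|a| * dsum_norm x.
Proof.
have [_ _ piZ _] := pnorm_norm pi.
rewrite /dsum_norm -piZ//; last exact: nonneg_norms.
by congr (pi _); apply/rowP => i; rewrite !mxE; exact: normrZ.
Qed.

Lemma dsum_norm0_eq0 x : dsum_norm x = 0 -> x = 0.
Proof.
have [_ _ _ pi0] := pnorm_norm pi.
move=> /(pi0 _ (nonneg_norms x))/rowP x0.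
apply: functional_extensionality_dep => i; apply/eqP.
by rewrite -normr_eq0; have := x0 i; rewrite !mxE => ->.
Qed.

HB.instance Definition _ := Lmodule_isNormed.Build R (dsum pi X)
  dsum_normD dsum_normZ dsum_norm0_eq0.

Lemma dsum_normE x : `|x| = pi (\row_i `|x i|).
Proof. by []. Qed.

Let e (i : 'I_k) : 'rV[R]_k := delta_mx 0 i.

Let e_ge0 i : nonneg_vec (e i).
Proof. by move=> j; rewrite mxE. Qed.

Let pie_gt0 i : 0 < pi (e i).
Proof.
have [pi_ge0 _ _ pi0] := pnorm_norm pi.
rewrite lt_neqAle pi_ge0// andbT eq_sym; apply/eqP => /(pi0 _ (e_ge0 i)) /rowP.
by move=> /(_ i); rewrite !mxE !eqxx => /eqP; rewrite oner_eq0.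
Qed.

Lemma dsum_norm_ge_coord x i : `|x i| * pi (e i) <= `|x|.
Proof.
have [_ _ piZ _] := pnorm_norm pi.
rewrite dsum_normE -piZ//; apply: pnorm_nondecreasing.
- by move=> j; rewrite !mxE mulr_ge0.
- exact: nonneg_norms.
- move=> j; rewrite !mxE eqxx; have [->|_] := eqVneq j i; first by rewrite mulr1.
  by rewrite mulr0.
Qed.

Lemma dsum_norm_le_sum x : `|x| <= \sum_i `|x i| * pi (e i).
Proof.
have [_ piD piZ pi0] := pnorm_norm pi.
rewrite dsum_normE (row_sum_delta (\row_i `|x i|)).
have /= : nonneg_vec (\sum_i (\row_j `|x j|) 0 i *: e i) /\
    pi (\sum_i (\row_j `|x j|) 0 i *: e i) <= \sum_i `|x i| * pi (e i).
  elim/big_rec2 : _ => [|i r t _ [t0 tr]].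
    split; first by move=> j; rewrite mxE.
    by rewrite (proj2 (pi0 0 _))// => j; rewrite mxE.
  have n0 : nonneg_vec ((\row_j `|x j|) 0 i *: e i).
    by move=> j; rewrite !mxE mulr_ge0.
  split; first exact: nonneg_vecD.
  apply: le_trans (piD _ _ n0 t0) _; rewrite lerD// piZ// mxE//.
by case.
Qed.

Lemma dsum_complete (F : set_system (dsum pi X)) :
  ProperFilter F -> cauchy F -> cvg F.
Proof.
move=> FF /cauchyP Fc.
have Fi i : cvg ((fun x : dsum pi X => x i) @ F).
  apply/cauchy_cvgP/cauchyP => eps eps0.
  have [x Fx] := Fc _ (mulr_gt0 eps0 (pie_gt0 i)).
  exists (x i); change (F [set y : dsum pi X | ball (x i) eps (y i)]).
  apply: filterS Fx => y; rewrite /= -!ball_normE /= => xy.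
  rewrite -(ltr_pM2r (pie_gt0 i)).
  exact: (le_lt_trans (dsum_norm_ge_coord (x - y) i) xy).
pose l : dsum pi X := fun i => lim ((fun x : dsum pi X => x i) @ F).
apply/cvg_ex; exists l; apply/fcvgrPdist_lt => eps eps0.
pose d i := eps / k.+1%:R / pi (e i).
have d0 i : 0 < d i by rewrite !divr_gt0.
have : \forall x \near F, forall i : 'I_k,
    `|l i - x i| < d i.
  apply: filter_forall => i.
  by have /cvgrPdist_lt/(_ _ (d0 i)) := Fi i.
apply: filterS => x lx.
apply: le_lt_trans (dsum_norm_le_sum _) _.
apply: (@le_lt_trans _ _ (\sum_(i < k) eps / k.+1%:R)).
  apply: ler_sum => i _; rewrite -ler_pdivlMr//; exact: ltW.
rewrite sumr_const card_ord -[ltLHS]mulr_natr -mulrA gtr_pMr// mulrC ltr_pdivrMr//.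
by rewrite mul1r ltr_nat.
Qed.

HB.instance Definition _ := Uniform_isComplete.Build (dsum pi X) dsum_complete.
End DsumZmodule.

(* Since the norm of the sum of subspaces Y i of X i is the restriction of    *)
(* the norm of dsum pi X, that sum is taken as a subset of dsum pi X.         *)
Definition dsum_set (R : realType) (k : nat) (pi : polyhedral_norm R k)
    (X : 'I_k -> completeNormedModType R) (Y : forall i, set (X i)) :
  set (dsum pi X) := [set x | forall i, Y i (x i)].
Arguments dsum_set {R k} pi {X} Y.

Section Subspaces.
Context (R : realType) (E : completeNormedModType R).
Implicit Types A D W X Y Z : set E.

Definition closed_subspace Y : Prop := submod_closed [in Y] /\ closed Y.

Definition linear_span A : set E := smallest (fun M => submod_closed [in M]) A.

Definition cball (c : E) (r : R) : set E := closed_ball_ Num.Def.normr c r.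

(* Y is a central subspace of X, where X is itself a subspace of E; the balls *)
(* of X are the sets X `&` cball c r.                                         *)
Definition central_subspace X Y : Prop :=
  [/\ closed_subspace Y, Y `<=` X &
    forall (n : nat) (y : 'I_n -> E) (r : 'I_n -> R),
      (forall i, Y (y i)) -> (forall i, 0 < r i) ->
      X `&` \bigcap_i cball (y i) (r i) !=set0 ->
      Y `&` \bigcap_i cball (y i) (r i) !=set0].

(* P is only meaningful on the domain D; its values outside D are junk.       *)
Definition linear_projection D W (P : E -> E) : Prop :=
  [/\ (forall (a : R) u v, D u -> D v -> P (a *: u + v) = a *: P u + P v),
      P @` D = W,
      W `<=` D &
      (forall u, D u -> P (P u) = P u)].

Definition op_norm D (P : E -> E) : \bar R :=
  ereal_sup [set (`|P u|)%:E | u in [set u | D u /\ `|u| <= 1]].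

(* An operator norm equal to 1 is required, so W is nonzero.                  *)
Definition norm_one_projection D W (P : E -> E) : Prop :=
  linear_projection D W P /\ op_norm D P = 1%E.

Definition locally_constrained Z1 Y Z2 : Prop :=
  forall z, Z1 z -> exists P Q : E -> E,
    [/\ norm_one_projection (linear_span (z |` Z2)) Z2 P,
        norm_one_projection (linear_span (z |` Y)) Y Q &
        P z = Q z].

End Subspaces.

(* Main.v *)
(* A point z of Z1 common to the given balls, whose centers lie in Z2, is     *)
(* moved into Z2 by applying coordinatewise the norm-one projections P_i onto *)
(* Z2i. As P_i fixes the centers, it does not increase the distance to them   *)
(* in any coordinate, and pi is nondecreasing.                                *)
Require Import Defs.
From mathcomp Require Import all_boot all_order all_algebra.
From mathcomp Require Import all_classical all_reals all_analysis.
Set Implicit Arguments.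
Unset Strict Implicit.
Unset Printing Implicit Defensive.
Import Order.TTheory GRing.Theory Num.Theory.
Import numFieldNormedType.Exports.
Local Open Scope classical_set_scope.
Local Open Scope ring_scope.

(** Centrality of the sum of the [Z1 i] trades the given common point for some [z] in that sum. The
    local constraint at [z i] then supplies [P_i], a contraction on the span of [z i] and [Z2i].
    [norm_one_projection_dist] gives the coordinate estimates, and [dsum_le_norm] combines them into
    an estimate in the sum. *)

Lemma orthant_norm_delta_gt0 (R : realType) (k : nat) (pi : 'rV[R]_k -> R)
  (i : 'I_k) : orthant_norm pi -> 0 < pi (delta_mx 0 i).
Proof.
case=> pi_ge0 _ _ pi0.
have e0 : @nonneg_vec R k (delta_mx 0 i) by move=> j; rewrite mxE.
rewrite lt_neqAle pi_ge0// andbT eq_sym; apply/eqP => /(pi0 _ e0) /rowP.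
by move=> /(_ i); rewrite !mxE !eqxx => /eqP; rewrite oner_eq0.
Qed.

(** The coordinate map is Lipschitz with constant [1 / pi (delta_mx 0 i)]. This is what makes a sum
    of closed subspaces closed. *)
Lemma dsum_coord_continuous (R : realType) (k : nat) (pi : polyhedral_norm R k)
  (X : 'I_k -> completeNormedModType R) (i : 'I_k) :
  continuous (fun x : dsum pi X => x i).
Proof.
have pie0 := orthant_norm_delta_gt0 i (pnorm_norm pi).
move=> x; have FF : Filter (nbhs x) by exact: nbhs_filter.
apply/(@cvgrPdist_lt _ _ _ (nbhs x) FF) => eps eps0.
near=> y; rewrite -(ltr_pM2r pie0).
apply: le_lt_trans (dsum_norm_ge_coord (x - y) i) _.
by near: y; apply: cvgr_dist_lt; [exact: cvg_id|exact: mulr_gt0].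
Unshelve. all: by end_near. Qed.

Lemma dsum_le_norm (R : realType) (k : nat) (pi : polyhedral_norm R k)
  (X : 'I_k -> completeNormedModType R) (x y : dsum pi X) :
  (forall i, `|x i| <= `|y i|) -> `|x| <= `|y|.
Proof.
move=> xy; rewrite !dsum_normE; apply: pnorm_nondecreasing.
- exact: nonneg_norms.
- exact: nonneg_norms.
- by move=> i; rewrite !mxE.
Qed.

Lemma closed_subspaceI (R : realType) (E : completeNormedModType R)
  (A B : set E) :
  closed_subspace A -> closed_subspace B -> closed_subspace (A `&` B).
Proof.
move=> [[A0 AD] cA] [[B0 BD] cB]; split; last exact: closedI.
split; first by rewrite inE; split; rewrite -in_setE.
move=> a u v; rewrite !inE => -[Au Bu] [Av Bv].
by split; rewrite -in_setE; [apply: AD | apply: BD]; rewrite inE.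
Qed.

Lemma dsum_set_closed_subspace (R : realType) (k : nat)
  (pi : polyhedral_norm R k) (X : 'I_k -> completeNormedModType R)
  (Y : forall i, set (X i)) :
  (forall i, closed_subspace (Y i)) -> closed_subspace (dsum_set pi Y).
Proof.
move=> hY; split.
  split=> [|a u v]; rewrite !inE; [move=> i|move=> uY vY i].
    by have [[Y0 _] _] := hY i; rewrite -in_setE.
  have [[_ YD] _] := hY i.
  by rewrite -in_setE; apply: YD; rewrite inE.
have -> : dsum_set pi Y = \bigcap_i ((fun x : dsum pi X => x i) @^-1` Y i).
  by apply/seteqP; split=> [x xY i _|x xY i]; exact: xY.
apply: closed_bigI => i _; apply: preimage_closed.
- by move=> x _; exact: dsum_coord_continuous.
- by case: (hY i).
Qed.

(** The supremum in [op_norm] only sees the unit ball, so a nonzero [u] is normalised first;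
    homogeneity of [P] comes from its linearity on [D] together with [P 0 = 0]. *)
Lemma norm_one_projection_le (R : realType) (E : completeNormedModType R)
  (D W : set E) (P : E -> E) (u : E) :
  submod_closed [in D] -> norm_one_projection D W P -> D u -> `|P u| <= `|u|.
Proof.
move=> [D0 DD] [[Plin _ _ _] P1] Du.
have {}D0 : D 0 by rewrite -in_setE.
have P0 : P 0 = 0.
  by apply: (addrI (P 0)); rewrite addr0 -{1}[P 0]scale1r -Plin// scale1r addr0.
have [->|u0] := eqVneq u 0; first by rewrite P0.
have nu0 : 0 < `|u| by rewrite normr_gt0.
have Dv : D (`|u|^-1 *: u).
  by rewrite -[_ *: _]addr0 -in_setE; apply: DD; rewrite inE.
have Pv : P (`|u|^-1 *: u) = `|u|^-1 *: P u.
  by rewrite -[_ *: u]addr0 Plin// P0 addr0.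
have : (`|P (`|u|^-1 *: u)|%:E <= op_norm D P)%E.
  apply: ereal_sup_ubound; exists (`|u|^-1 *: u) => //; split=> //.
  by rewrite normrZ normfV normr_id mulVf// gt_eqF.
rewrite P1 lee_fin Pv normrZ normfV normr_id.
by rewrite mulrC ler_pdivrMr// mul1r.
Qed.

Lemma linear_span_submod_closed (R : realType) (E : completeNormedModType R)
  (A : set E) : submod_closed [in linear_span A].
Proof.
split; first by rewrite inE => M [[M0 _] _]; exact: (set_mem M0).
move=> a u v; rewrite !inE => uA vA M MA; have [[_ MD] _] := MA.
by apply: set_mem; apply: MD; apply: mem_set; [exact: uA|exact: vA].
Qed.

(** A projection fixes [w], so [w - P u] is the image of [w - u] under a contraction. *)
Lemma norm_one_projection_dist (R : realType) (E : completeNormedModType R)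
  (D W : set E) (P : E -> E) (u w : E) :
  submod_closed [in D] -> norm_one_projection D W P -> D u -> W w ->
  `|w - P u| <= `|w - u|.
Proof.
move=> hD hP Du Ww; have [[Plin PW WD Pid] _] := hP.
have Pw : P w = w by move: Ww; rewrite -PW => -[v Dv <-]; exact: Pid.
have := hD => -[_ DD].
have Dwu : D (w - u).
  rewrite addrC -scaleN1r -in_setE; apply: DD; rewrite inE//; exact: WD.
suff <- : P (w - u) = w - P u by apply: norm_one_projection_le hD hP Dwu.
by rewrite addrC -scaleN1r Plin//; [rewrite Pw scaleN1r addrC|exact: WD].
Qed.

Theorem theorem2p8 (R : realType) (k : nat)
    (X : 'I_k -> completeNormedModType R)
    (Y Z1 : forall i : 'I_k, set (X i))
    (hY : forall i, closed_subspace (Y i))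
    (hZ1 : forall i, closed_subspace (Z1 i))
    (hlc : forall i, locally_constrained (Z1 i) (Y i) (Y i `&` Z1 i))
    (pi : polyhedral_norm R k) :
  central_subspace setT (dsum_set pi Z1) ->
  central_subspace (dsum_set pi Y) (dsum_set pi (fun i => Y i `&` Z1 i)).
Proof.
move=> [_ _ central]; split.
- by apply: dsum_set_closed_subspace => i; exact: closed_subspaceI.
- by move=> x xYZ i; case: (xYZ i).
move=> n a r aYZ r0 [y [_ yB]].
have [||z [zZ1 zB]] := central n a r _ r0; first by move=> j i; case: (aYZ j i).
  by exists y.
(* The projection depends on [z i] but not on the ball, so a single [w] serves all the centers [a j]
   at once. *)
have coord i : exists w, (Y i `&` Z1 i) w /\
    forall j, `|a j i - w| <= `|a j i - z i|.
  have [P [_ [hP _ _]]] := hlc i (z i) (zZ1 i).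
  have Dz : linear_span (z i |` (Y i `&` Z1 i)) (z i).
    by apply: sub_gen_smallest; left.
  exists (P (z i)); split.
    by have [[_ <- _ _] _] := hP; exists (z i).
  move=> j; apply: norm_one_projection_dist hP Dz _; last exact: aYZ.
  exact: linear_span_submod_closed.
pose w : dsum pi X := fun i => projT1 (cid (coord i)).
exists w; split=> [i|j _]; first by rewrite /w; case: cid => ? [].
apply: le_trans (zB j I); apply: dsum_le_norm => i.
(* Subtraction in [dsum pi X] is coordinatewise by definition. *)
by change (`|a j i - w i| <= `|a j i - z i|); rewrite /w; case: cid => ? [].
Qed.
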